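(* Let $\sigma = (\sigma_j)_{j\ge1}$ be an infinite increasing sequence of positive integers with $\sigma_1 \geq 3$, and let $\tau = (\tau_i)_{i\ge1}$ be an arbitrary infinite subsequence of $\sigma$ with $\tau_1 = \sigma_1$. Set $\tau_0 = 1$, $\triangle_1 = 1$, and for $i \ge 2$ let $\triangle_i := \max\{\sigma_j - \sigma_{j-1} : j\ge 2,\ \sigma_j \leq \tau_i\}$. For $r \ge 1$ let $P_r$ be the family of all graphs containing no cycle of any length $\sigma_j$ with $\sigma_j \leq \tau_r$. Then for every $r\ge1$, every $n$-vertex graph $G \in P_r$ satisfies \[ \iota(G) < 27^r \sigma_1 \exp\Bigl(\sum_{i=1}^r \frac{2\log \triangle_i}{\tau_{i-1}} + \frac{2\log n}{\tau_r}\Bigr). \]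
   Context: All graphs are finite and simple. For nonempty $X \subseteq V(G)$, $\alpha(X)$ is the independence number of the subgraph induced by $X$, and $\iota(G) := \sup_{\emptyset\neq X \subseteq V(G)} |X|/\alpha(X)$. $\log$ is the natural logarithm. *)

(* Defs.v *)
From HB Require Import structures.
From mathcomp Require Import all_boot all_order all_algebra.
From mathcomp Require Import classical_sets reals.

Set Implicit Arguments.
Unset Strict Implicit.
Unset Printing Implicit Defensive.

Import Order.TTheory GRing.Theory Num.Theory.

Local Open Scope nat_scope.

Record sgraph := SGraph {
  vertex :> finType;
  adj : rel vertex;
  adj_sym : symmetric adj;
  adj_irr : irreflexive adj
}.

Definition independent (G : sgraph) (S : {set G}) : bool :=
  [forall x in S, forall y in S, ~~ adj x y].

Definition alpha (G : sgraph) (X : {set G}) : nat :=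
  \max_(S : {set G} | (S \subset X) && independent S) #|S|.

(* The supremum is over a finite set, nonempty as soon as G has a vertex; for
   the graph without vertices [sup] is 0 by convention. *)
Definition iota_ratio (R : realType) (G : sgraph) : R :=
  sup [set q : R | exists X : {set G},
         (0 < #|X|) /\ q = (#|X|%:R / (alpha X)%:R)%R]%classic.

Definition has_cycle (G : sgraph) (k : nat) : Prop :=
  exists c : seq G, [/\ 3 <= k, size c = k & ucycle (@adj G) c].

(* Sequences (s_j)_{j >= 1} are functions on nat whose value at 0 is not part of
   the sequence. *)
Definition strictly_increasing (s : nat -> nat) : Prop :=
  forall i j, 1 <= i -> i < j -> s i < s j.

Definition subsequence (t s : nat -> nat) : Prop :=
  exists k : nat -> nat,
    [/\ forall i, 1 <= i -> 1 <= k i,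
        strictly_increasing k &
        forall i, 1 <= i -> t i = s (k i)].

(* The bound j <= tau i loses no index: sigma j >= j for an increasing sequence
   of positive integers, so sigma j <= tau i forces j <= tau i.  As sigma is
   increasing, the truncated subtraction is the usual one. *)
Definition gap (sigma tau : nat -> nat) (i : nat) : nat :=
  if i <= 1 then 1
  else \max_(2 <= j < (tau i).+1 | sigma j <= tau i) (sigma j - sigma j.-1).

Definition cycle_free_family (sigma tau : nat -> nat) (r : nat) (G : sgraph) :
    Prop :=
  forall j, 1 <= j -> sigma j <= tau r -> ~ has_cycle G (sigma j).

(* Main.v *)
Require Import Defs.
From HB Require Import structures.
From mathcomp Require Import all_boot all_order all_algebra.
From mathcomp Require Import zify lra.
From mathcomp Require Import reals.
From mathcomp.analysis Require Import sequences exp.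

(* By induction on [r], [#|X| < ratio_bound r #|X| * alpha X] for every nonempty
   vertex set [X].  If this fails for [X], pass to a minimal subset [Z] for
   which it fails with the same constant: [Z] is connected and every independent
   [S \subset Z] satisfies [ratio_bound r #|X| * #|S| <= #|closed_nbhd Z S|].
   Take a breadth-first search tree of [Z].
   - A layer at distance [l < tau r / 2] has independence ratio less than
     [4 * f], where [f] bounds the independence ratio of sets of at most
     [D = max(gap r, sigma 1 - 2)] vertices.  Otherwise it contains a connected
     set [K] of ratio at least [4 * f].  Let [s] be the height of the lowest
     common ancestor of [K].  Some group [A] of branches there keeps ratio
     [2 * f], so a minimal such subset of [A] expands every set of at most [D]
     vertices by a factor 2, and depth-first search gives a path of any length
     [w <= D] starting in [K :\: A] and then staying in [A].  With the tree this
     is a cycle of length [2 * s + w], and [w] can be chosen so that this number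
     is a [sigma j <= tau r].
   - Hence the layers grow by a factor [5 * #|X|^(2 / tau r)], so the layer at
     distance [uphalf (tau r)] has more than [#|X|] vertices.
   For [D = gap r] the induction hypothesis gives [f], and [f = sigma 1] will do
   for [D = sigma 1 - 2]. *)

Set Implicit Arguments.
Unset Strict Implicit.
Unset Printing Implicit Defensive.

Import Order.TTheory GRing.Theory Num.Theory.

Local Open Scope nat_scope.

(** * Independent sets, closed neighbourhoods and cuts *)

Section Graphs.
Variable G : sgraph.
Implicit Types (S X Y Z U A C K : {set G}).

Definition closed_nbhd Z S : {set G} :=
  [set y in Z | (y \in S) || [exists x in S, adj x y]].

(** Connectivity is phrased by cuts, the form that minimality of a set yields directly. *)
Definition connected_set Z : Prop :=
  forall U, U \subset Z -> U != set0 -> U != Z ->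
  exists x y, [/\ x \in U, y \in Z, y \notin U & adj x y].

Lemma independentP S :
  reflect (forall x y, x \in S -> y \in S -> ~~ adj x y) (independent S).
Proof.
apply: (iffP forall_inP) => [H x y xS yS|H x xS].
  by have /forall_inP/(_ y yS) := H x xS.
by apply/forall_inP => y yS; apply: H.
Qed.

Lemma alpha_ge S X : S \subset X -> independent S -> #|S| <= alpha X.
Proof. by move=> sSX iS; apply: (leq_bigmax_cond S); rewrite sSX. Qed.

Lemma alpha_witness X :
  exists S, [/\ S \subset X, independent S & #|S| = alpha X].
Proof.
have [|S /andP[sSX iS] eqS] := @eq_bigmax_cond _
  [pred S : {set G} | (S \subset X) && independent S] (fun S => #|S|).
  apply/card_gt0P; exists set0; rewrite inE sub0set /=.
  by apply/independentP => x y; rewrite inE.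
by exists S; rewrite -eqS.
Qed.

Lemma alpha_mono X Y : X \subset Y -> alpha X <= alpha Y.
Proof.
move=> sXY; have [S [sSX iS <-]] := alpha_witness X.
by rewrite alpha_ge // (subset_trans sSX).
Qed.

Lemma alpha_gt0 X : X != set0 -> 0 < alpha X.
Proof.
case/set0Pn=> x xX; rewrite -(cards1 x) alpha_ge ?sub1set //.
by apply/independentP => y z /set1P-> /set1P->; rewrite adj_irr.
Qed.

Lemma alphaU X Y : (forall x y, x \in X -> y \in Y -> ~~ adj x y) ->
  [disjoint X & Y] -> alpha X + alpha Y <= alpha (X :|: Y).
Proof.
move=> nXY dXY.
have [S [sSX iS <-]] := alpha_witness X.
have [S' [sSY iS' <-]] := alpha_witness Y.
have dSS : [disjoint S & S'].
  by apply: disjointWl sSX _; apply: disjointWr sSY _.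
have -> : #|S| + #|S'| = #|S :|: S'|.
  by rewrite cardsU (disjoint_setI0 dSS) cards0 subn0.
apply: alpha_ge; first exact: setUSS.
apply/independentP => x y /setUP[xS|xS] /setUP[yS|yS].
- by move/independentP: iS; apply.
- by apply: nXY; [apply: (subsetP sSX)|apply: (subsetP sSY)].
- by rewrite adj_sym; apply: nXY; [apply: (subsetP sSX)|apply: (subsetP sSY)].
- by move/independentP: iS'; apply.
Qed.

Lemma alphaD X Z : X \subset Z ->
  (forall x y, x \in X -> y \in Z :\: X -> ~~ adj x y) ->
  alpha X + alpha (Z :\: X) <= alpha Z.
Proof.
move=> sXZ nXZ; rewrite -[X in _ <= alpha X](setID Z X) (setIidPr sXZ).
apply: alphaU => //; rewrite disjoint_subset; apply/subsetP=> x.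
by rewrite !inE => ->.
Qed.

Lemma closed_nbhd_sub Z S : closed_nbhd Z S \subset Z.
Proof. by apply/subsetP => x; rewrite inE => /andP[]. Qed.

Lemma sub_closed_nbhd Z S : S \subset Z -> S \subset closed_nbhd Z S.
Proof. by move=> /subsetP sSZ; apply/subsetP => x xS; rewrite inE sSZ ?xS. Qed.

Lemma closed_nbhd_mono Z S Y : S \subset Y ->
  closed_nbhd Z S \subset closed_nbhd Z Y.
Proof.
move=> /subsetP sSY; apply/subsetP => x; rewrite !inE => /andP[->] /=.
case/orP=> [/sSY->//|/exists_inP[y /sSY yY yx]].
by apply/orP; right; apply/exists_inP; exists y.
Qed.

(** No edge joins [S] to the part of [Z] outside its closed neighbourhood, so [S] extends any
    independent set found there. *)
Lemma alpha_remove_nbhd Z S : S \subset Z -> independent S ->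
  #|S| + alpha (Z :\: closed_nbhd Z S) <= alpha Z.
Proof.
move=> sSZ iS.
have -> : #|S| = alpha S.
  apply/eqP; rewrite eqn_leq alpha_ge //=.
  by have [S' [sS' _ <-]] := alpha_witness S; apply: subset_leq_card.
apply: leq_trans (_ : _ <= alpha (S :|: (Z :\: closed_nbhd Z S))) _.
  apply: alphaU.
    move=> x y xS; rewrite !inE => /andP[+ yZ]; rewrite yZ /= negb_or.
    case/andP=> _; apply: contra => xy; apply/exists_inP; by exists x.
  rewrite disjoint_subset; apply/subsetP => x xS.
  by rewrite !inE (subsetP sSZ) // xS.
by apply: alpha_mono; rewrite subUset sSZ subsetDl.
Qed.

(** * Minimal subsets of large independence ratio *)

Local Open Scope ring_scope.

(* Minimality does all the work: deleting [closed_nbhd Z S], or one side of a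
   disconnection, leaves sets for which the inequality fails strictly. *)
Lemma minimal_dense (R : realFieldType) (rho : R) X :
  0 <= rho -> X != set0 -> rho * (alpha X)%:R <= #|X|%:R ->
  exists Z, [/\ Z \subset X, Z != set0, rho * (alpha Z)%:R <= #|Z|%:R,
    connected_set Z &
    forall S, S \subset Z -> independent S ->
      rho * #|S|%:R <= #|closed_nbhd Z S|%:R].
Proof.
move=> rho0 X0 badX.
pose P := [pred Z : {set G} | (Z != set0) && (rho * (alpha Z)%:R <= #|Z|%:R)].
have PX : P X by rewrite /= X0.
have [Z /minsetP[/andP[Z0 badZ] minZ] sZX] := minset_exists PX.
have small_lt Y : Y \subset Z -> Y != Z -> Y != set0 ->
    #|Y|%:R < rho * (alpha Y)%:R.
  move=> sYZ nYZ Y0; rewrite ltNge; apply: contra nYZ => bY.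
  by apply/eqP/minZ => //=; rewrite Y0.
(* Strictness is lost here because the difference may be empty. *)
have small_le X' : X' \subset Z -> X' != set0 ->
    #|Z :\: X'|%:R <= rho * (alpha (Z :\: X'))%:R.
  move=> sXZ' /set0Pn[x xX'].
  have [->|Y0] := eqVneq (Z :\: X') set0; first by rewrite cards0 mulr_ge0.
  apply/ltW/small_lt; rewrite ?subsetDl //; apply/eqP => /setP/(_ x).
  by rewrite !inE xX' (subsetP sXZ').
exists Z; split=> //.
- move=> U sUZ U0 UZ.
  have [/existsP[x /existsP[y /and4P[]]]|no] := boolP [exists x, exists y,
    [&& x \in U, y \in Z, y \notin U & adj x y]].
    by exists x, y.
  have ltU := small_lt U sUZ UZ U0.
  have leD := small_le U sUZ U0.
  have aU : (alpha U + alpha (Z :\: U) <= alpha Z)%N.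
    apply: alphaD => // x y xU; rewrite inE => /andP[yU yZ].
    apply: contra no => xy; apply/existsP; exists x; apply/existsP; exists y.
    by rewrite xU yZ yU.
  have cU : (#|U| + #|Z :\: U| = #|Z|)%N.
    by rewrite -(cardsID U Z) (setIidPr sUZ).
  move: badZ; rewrite -cU natrD => badZ.
  have : rho * (alpha U + alpha (Z :\: U))%:R <= rho * (alpha Z)%:R.
    by rewrite ler_wpM2l // ler_nat.
  by rewrite natrD mulrDr => h; exfalso; lra.
- move=> S sSZ iS.
  have [->|S0] := eqVneq S set0; first by rewrite cards0 mulr0.
  have aS := alpha_remove_nbhd sSZ iS.
  have leD : #|Z :\: closed_nbhd Z S|%:R
      <= rho * (alpha (Z :\: closed_nbhd Z S))%:R.
    apply: small_le; first exact: closed_nbhd_sub.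
    apply: contraNneq S0 => nS0.
    by rewrite -subset0 -nS0 sub_closed_nbhd.
  have cS : (#|closed_nbhd Z S| + #|Z :\: closed_nbhd Z S| = #|Z|)%N.
    by rewrite -(cardsID (closed_nbhd Z S) Z) (setIidPr (closed_nbhd_sub _ _)).
  move: badZ; rewrite -cS natrD => badZ.
  have : rho * (#|S| + alpha (Z :\: closed_nbhd Z S))%:R <= rho * (alpha Z)%:R.
    by rewrite ler_wpM2l // ler_nat.
  by rewrite natrD mulrDr => h; lra.
Qed.

(** * Long paths in expanding sets *)

Local Open Scope nat_scope.

Definition path_in A (x : G) (p : seq G) :=
  [/\ path (@adj G) x p, uniq (x :: p) & {subset p <= A}].

(* Depth-first search: [p] is the stack and [S] the set of exhausted vertices,
   so that all neighbours of [S] lie in [S] or on the stack. *)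
Lemma long_path A a D : a \in A ->
  (forall Y, Y \subset A -> Y != set0 -> #|Y| <= D ->
     #|Y|.*2 <= #|closed_nbhd A Y|) ->
  exists2 p, path_in A a p & D <= (size p).+1.
Proof.
move=> aA expand.
(* The fuel [n] bounds the remaining moves: each push or pop raises [#|S|.*2 + size p] by one. Once
   this reaches [3 * D] while [#|S| <= D], the stack is long enough. *)
suff dfs n S p : S \subset A -> path_in A a p -> [disjoint S & a :: p] ->
    closed_nbhd A S \subset S :|: [set x in a :: p] -> #|S| <= D ->
    3 * D <= n + (#|S|.*2 + size p) ->
    exists2 p, path_in A a p & D <= (size p).+1.
  apply: (dfs (3 * D) set0 [::]); rewrite ?cards0 ?sub0set //.
  - by rewrite disjoint_subset; apply/subsetP => x; rewrite inE.
  - apply/subsetP => x; rewrite !inE => /andP[_ /exists_inP[y]].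
    by rewrite inE.
  - by rewrite leq_addr.
elim: n S p => [|n IHn] S p sSA pp dSp nS leSD leD.
  exists p => //; lia.
have [leDp|ltpD] := leqP D (size p).+1; first by exists p.
have [/existsP[y /and4P[yA yS yp xy]]|no] := boolP [exists y,
    [&& y \in A, y \notin S, y \notin a :: p & adj (last a p) y]].
  apply: (IHn S (rcons p y)) => //.
  - case: pp => pp up sp; split.
    + by rewrite rcons_path pp.
    + by rewrite -rcons_cons rcons_uniq yp.
    + by move=> z; rewrite mem_rcons inE => /predU1P[->|/sp].
  - rewrite -rcons_cons disjoint_sym disjoint_has has_rcons negb_or yS.
    by rewrite -disjoint_has disjoint_sym.
  - apply: subset_trans nS (setUS _ _); apply/subsetP => z.
    by rewrite !inE mem_rcons inE => /orP[->|->]; rewrite ?orbT.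
  - by rewrite size_rcons; lia.
have D0 : 0 < D by lia.
(* If [#|S| = D], then [S] has at least [2 * D] closed neighbours, all among [S] and a stack of
   fewer than [D] vertices. *)
have ltSD : #|S| < D.
  rewrite ltn_neqAle leSD andbT; apply/eqP => eSD.
  have S0 : S != set0 by rewrite -card_gt0 eSD.
  have := expand S sSA S0 leSD; have := subset_leq_card nS.
  have := (leq_card_setU S [set x in a :: p]).1.
  have : #|[set x in a :: p]| <= (size p).+1.
    by rewrite cardsE; apply: (card_size (a :: p)).
  lia.
case: pp => pp up sp.
have lp : last a p \in a :: p by exact: mem_last.
have lA : last a p \in A by move: lp; rewrite inE => /predU1P[->|/sp].
have lS : last a p \notin S.
  by move: dSp; rewrite disjoint_sym => /disjointFr->.
have cS' : #|last a p |: S| = #|S|.+1 by rewrite cardsU1 lS.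
have nS' : closed_nbhd A (last a p |: S) \subset S :|: [set x in a :: p].
  apply/subsetP => y; rewrite inE => /andP[yA yn].
  have [ySp|] := boolP (y \in S :|: [set x in a :: p]) => //.
  rewrite !inE negb_or => /andP[yS yp].
  case/negP: no; apply/existsP; exists y; rewrite yA yS inE yp /=.
  have : y \notin closed_nbhd A S.
    by apply: contra yS => /(subsetP nS); rewrite !inE (negPf yp) orbF.
  rewrite inE yA (negPf yS) /= => nyS.
  move: yn; rewrite !inE (negPf yS) orbF => /orP[/eqP eyx|].
    by move: lp; rewrite -eyx inE (negPf yp).
  case/exists_inP => x /setU1P[->//|xS xy].
  by case/exists_inP: nyS; exists x.
have sS'A : last a p |: S \subset A.
  by apply/subsetP => y /setU1P[->//|/(subsetP sSA)].
(* The top of the stack is exhausted. If it is the root [a], then [a |: S] is its own closed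
   neighbourhood, against expansion; otherwise it is popped. *)
case/lastP: p => [|p x] in pp up sp dSp nS leD ltpD no lp lA lS cS' nS' sS'A *.
  have : a |: S != set0 by apply/set0Pn; exists a; rewrite setU11.
  move=> /(expand _ sS'A); rewrite cS' => /(_ ltSD).
  have : S :|: [set x in [:: a]] = a |: S.
    by apply/setP => y; rewrite !inE orbC.
  move: nS' => /= /subset_leq_card + eS; rewrite eS cS' => le1 le2.
  by have := leq_trans le2 le1; rewrite -addnn leqNgt addSn ltnS leq_addl.
rewrite last_rcons in lp lA lS cS' nS' sS'A no.
move: pp up; rewrite rcons_path -rcons_cons rcons_uniq => /andP[pp xlp].
move=> /andP[xp up].
apply: (IHn (x |: S) p) => //.
- by split=> // z zp; apply: sp; rewrite mem_rcons inE zp orbT.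
- rewrite disjoint_subset; apply/subsetP => z /setU1P[->|zS].
    by rewrite inE.
  move: dSp => /disjointFr/(_ zS); rewrite -rcons_cons mem_rcons inE => /norP[].
  by [].
- apply: subset_trans nS' _; apply/subsetP => z.
  rewrite !inE mem_rcons inE.
  by case: (z \in S); case: (z == a); case: (z == x); case: (z \in p).
- by rewrite cS'.
- by move: leD; rewrite cS' size_rcons doubleS !(addnS, addSn).
Qed.

Lemma first_hit C (x : G) (p : seq G) :
  path (@adj G) x p -> uniq (x :: p) -> last x p \in C -> x \notin C ->
  exists q a, [/\ path (@adj G) x (rcons q a), uniq (x :: rcons q a), a \in C,
    {subset rcons q a <= p} & {in q, forall z, z \notin C}].
Proof.
elim: p x => [|y p IHp] x /=; first by move=> _ _ ->.
case/andP=> xy pyp; rewrite inE negb_or => /andP[/andP[nxy xp] /andP[yp up]].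
have [yC _ _|yC lC xC] := boolP (y \in C).
  exists [::], y; split=> //=; first by rewrite xy.
  - by rewrite inE nxy.
  - by move=> z; rewrite !inE => ->.
have /= := IHp y pyp _ lC yC.
rewrite yp up => /(_ isT)[q [a [pq uq aC sq nq]]].
exists (y :: q), a; split=> //=.
- by rewrite xy.
- rewrite inE negb_or nxy uq andbT.
  by apply: contra xp => /sq.
- move=> z; rewrite inE => /predU1P[->|/sq]; rewrite inE ?eqxx // => ->.
  by rewrite orbT.
- by move=> z; rewrite inE => /predU1P[->|/nq].
Qed.

(** Let [U] be the part of [A] that reaches [A'] inside [A]. By connectivity an edge of [K] leaves
    [U], and its outer end [b] cannot lie in [A]. From [b], a path through [U] is cut at its first
    vertex in [A']. *)
Lemma entry_path K A A' : connected_set K -> A \subset K -> A != K ->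
  A' \subset A -> A' != set0 ->
  exists b q a, [/\ b \in K :\: A, a \in A', path (@adj G) b (rcons q a),
    uniq (b :: rcons q a) & {subset q <= A :\: A'}].
Proof.
move=> cK sAK nAK sA'A /set0Pn[a0 a0A'].
pose eA := [rel x y : G | [&& adj x y, x \in A & y \in A]].
pose U := [set u in A | [exists a in A', connect eA u a]].
have sUA : U \subset A by apply/subsetP => u; rewrite inE => /andP[].
have sA'U : A' \subset U.
  apply/subsetP => u uA'; rewrite inE (subsetP sA'A) //=.
  by apply/exists_inP; exists u.
have [||u [b [uU bK bU ub]]] := cK U (subset_trans sUA sAK).
- by apply/set0Pn; exists a0; apply: (subsetP sA'U).
- by apply: contraNneq nAK => UK; rewrite eqEsubset sAK -UK.
have bA : b \notin A.
  apply: contra bU => bA; rewrite inE bA /=.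
  move: uU; rewrite inE => /andP[uA /exists_inP[a aA' ua]].
  apply/exists_inP; exists a => //; apply: connect_trans ua.
  by apply: connect1; rewrite /= adj_sym ub bA uA.
have bD : b \in K :\: A by rewrite inE bA.
move: (uU); rewrite inE => /andP[uA /exists_inP[a aA' /connectP[p0 pp0 ea]]].
have [uA'|uA'] := boolP (u \in A').
  exists b, [::], u; split=> //=; first by rewrite adj_sym ub.
  by rewrite inE andbT; apply: contraNneq bA => ->.
case/shortenP: pp0 ea => p pp up _ ea.
have sp : {subset p <= A}.
  elim: p u pp {ub uU uA uA' up ea} => //= y p IHp u /andP[/and3P[_ _ yA] pp] z.
  by rewrite inE => /predU1P[->//|]; apply: IHp pp _.
have pp' : path (@adj G) u p by apply: sub_path pp => x y /and3P[].
have [|q [a' [pq uq a'A' sq nq]]] := first_hit (C := A') pp' up _ uA'.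
  by rewrite -ea.
exists b, (u :: q), a'; split=> //=.
- by rewrite adj_sym ub.
- move: uq => /= ->; rewrite andbT.
  apply: contra bA; rewrite inE => /predU1P[->//|/sq/sp//].
- move=> z; rewrite !inE => /predU1P[->|zq]; first by rewrite uA' uA.
  by rewrite nq //= sp // sq // mem_rcons inE zq orbT.
Qed.

(** An entry path into [A'] is prolonged by a depth-first path inside [A']. Only the start lies
    outside [A], so the path may be truncated to exactly [w] edges. *)
Lemma crossing_path K A A' w : connected_set K -> A \subset K -> A != K ->
  A' \subset A -> A' != set0 ->
  (forall Y, Y \subset A' -> Y != set0 -> #|Y| <= w ->
     #|Y|.*2 <= #|closed_nbhd A' Y|) ->
  exists b p, [/\ b \in K :\: A, path_in A b p & size p = w].
Proof.
move=> cK sAK nAK sA'A A'0 expand.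
have [b [q [a [bD aA' pq uq sq]]]] := entry_path cK sAK nAK sA'A A'0.
have [p [pp up sp] lewp] := long_path aA' expand.
pose r := rcons q a ++ p.
have sr : {subset r <= A}.
  move=> z; rewrite mem_cat mem_rcons inE -orbA => /or3P[/eqP->|/sq|/sp].
  - exact: (subsetP sA'A).
  - by rewrite inE => /andP[].
  - exact: (subsetP sA'A).
exists b, (take w r); split=> //.
  split.
  - by apply: take_path; rewrite cat_path pq last_rcons.
  - rewrite -[_ :: _]/(take w.+1 (b :: r)); apply: take_uniq.
    have [ap up'] : a \notin p /\ uniq p by apply/andP.
    rewrite -cat_cons cat_uniq uq up' andbT /=.
    apply/hasPn => z zp; have zA' := sp z zp.
    rewrite -rcons_cons mem_rcons !inE !negb_or; apply/and3P; split.
    + by apply: contraNneq ap => <-.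
    + move: bD; rewrite inE => /andP[bA _].
      by apply: contraNneq bA => <-; apply: (subsetP sA'A).
    + by apply/negP => /sq; rewrite inE zA'.
  - by move=> z /mem_take/sr.
by rewrite size_takel // size_cat size_rcons; lia.
Qed.

(** * Breadth-first search trees and the cycles they close *)

Record bfs_tree Z (v : G) (d : G -> nat) (par : G -> G) : Prop := BfsTree {
  bfs_root : forall x, x \in Z -> d x = 0 -> x = v;
  bfs_par : forall x, x \in Z -> 0 < d x ->
    [/\ par x \in Z, adj x (par x) & d x = (d (par x)).+1];
  bfs_adj : forall x y, x \in Z -> y \in Z -> adj x y -> d y <= (d x).+1;
  bfs_v : d v = 0
}.

Lemma bfs_tree_exists Z v : connected_set Z -> v \in Z ->
  exists d par, bfs_tree Z v d par.
Proof.
move=> cZ vZ.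
pose ball := fix ball l :=
  if l is l'.+1 then closed_nbhd Z (ball l') else [set v].
have ballZ l : ball l \subset Z.
  by case: l => [|l]; rewrite ?sub1set //= closed_nbhd_sub.
have ballS l : ball l \subset ball l.+1 by apply: sub_closed_nbhd.
have vball l : v \in ball l.
  by elim: l => [|l IHl]; rewrite ?set11 // (subsetP (ballS l)).
(* By connectivity each ball gains a vertex until it fills [Z], so radius [#|Z|] suffices. *)
have card_ball l : (l < #|ball l|) \/ ball l = Z.
  elim: l => [|l [IHl|IHl]]; first by left; rewrite cards1.
    have [eZ|nZ] := eqVneq (ball l) Z; [right|left].
      apply/eqP; rewrite eqEsubset ballZ.
      by apply: subset_trans (ballS l); rewrite eZ.
    have [|x [y [xb yZ yb xy]]] := cZ (ball l) (ballZ l) _ nZ.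
      by apply/set0Pn; exists v.
    apply: leq_trans (proper_card (_ : ball l \proper ball l.+1)).
      exact: IHl.
    apply/properP; split; first exact: ballS.
    exists y => //=; rewrite inE yZ; apply/orP; right.
    by apply/exists_inP; exists x.
  right; apply/eqP; rewrite eqEsubset ballZ.
  by apply: subset_trans (ballS l); rewrite IHl.
have ballE : ball #|Z| = Z.
  case: (card_ball #|Z|) => // lt; apply/eqP; rewrite eqEcard ballZ.
  exact: ltnW.
pose d x := find (fun l => x \in ball l) (iota 0 #|Z|.+1).
have nth_d x l : l < d x -> nth 0 (iota 0 #|Z|.+1) l = l.
  move=> ltl; rewrite nth_iota // -[#|Z|.+1](size_iota 0).
  exact: leq_trans ltl (find_size _ _).
have d_le x l : x \in ball l -> d x <= l.
  move=> xl; rewrite leqNgt; apply/negP => ltl.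
  by have := before_find 0 ltl; rewrite (nth_d x) // xl.
have ball_d x : x \in Z -> x \in ball (d x).
  move=> xZ; have dZ : d x <= #|Z| by apply: d_le; rewrite ballE.
  have hx : has (fun l => x \in ball l) (iota 0 #|Z|.+1).
    by rewrite has_find size_iota ltnS.
  by have := nth_find 0 hx; rewrite nth_iota ?ltnS // add0n.
have ball_adj x y : x \in Z -> y \in Z -> adj x y -> y \in ball (d x).+1.
  move=> xZ yZ xy; rewrite /= inE yZ; apply/orP; right.
  by apply/exists_inP; exists x; rewrite ?ball_d.
(* Within [Z], the default [x] is taken only at the root. *)
exists d, (fun x => odflt x [pick y in ball (d x).-1 | adj x y]); split.
- by move=> x /ball_d + dx; rewrite dx => /set1P.
- move=> x xZ d0; case: pickP => [y /andP[yb xy]|no] /=.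
    have yZ := subsetP (ballZ _) _ yb.
    split=> //; apply/eqP; rewrite eqn_leq; apply/andP; split.
      by apply/d_le/ball_adj; rewrite // adj_sym.
    by rewrite -[leqRHS](prednK d0) ltnS d_le.
  have := ball_d x xZ; rewrite -(prednK d0) /= inE xZ /=; case/orP=> [xb|].
    by have := d_le _ _ xb; rewrite leqNgt prednK // leqnn.
  by case/exists_inP=> y yb yx; have := no y; rewrite yb adj_sym yx.
- by move=> x y xZ yZ xy; apply/d_le/ball_adj.
- by apply/eqP; rewrite -leqn0 d_le // vball.
Qed.

Definition layer Z (d : G -> nat) (l : nat) := [set x in Z | d x == l].

Lemma iter_par Z v d par x i : bfs_tree Z v d par -> x \in Z -> i <= d x ->
  iter i par x \in Z /\ d (iter i par x) = d x - i.
Proof.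
move=> T xZ; elim: i => [|i IHi] lei; first by rewrite subn0.
have [yZ dy] := IHi (ltnW lei).
have [|pZ _ dp] := bfs_par T yZ; first by rewrite dy subn_gt0.
by split=> //=; rewrite subnS -dy dp.
Qed.

Lemma ancestor_path Z v d par x s : bfs_tree Z v d par -> x \in Z ->
  s <= d x -> path (@adj G) x (traject par (par x) s).
Proof.
move=> T; elim: s x => // s IHs x xZ les /=.
have [|pZ -> dx] := bfs_par T xZ; first exact: leq_ltn_trans les.
by rewrite IHs // -ltnS -dx.
Qed.

Lemma ancestor_traject Z v d par x s z : bfs_tree Z v d par -> x \in Z ->
  s <= d x -> z \in traject par (par x) s ->
  exists2 i, 0 < i <= s & z = iter i par x /\ d z = d x - i.
Proof.
move=> T xZ les /trajectP[i ltis ->]; exists i.+1 => //.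
rewrite -iterSr; split=> //.
by have [] := iter_par T xZ (leq_trans ltis les).
Qed.

Lemma ancestor_uniq Z v d par x s : bfs_tree Z v d par -> x \in Z ->
  s <= d x -> uniq (traject par (par x) s).
Proof.
move=> T; elim: s x => // s IHs x xZ les.
have [|pZ _ dx] := bfs_par T xZ; first exact: leq_ltn_trans les.
have lesp : s <= d (par x) by rewrite -ltnS -dx.
rewrite trajectS /= IHs // andbT; apply/negP.
case/(ancestor_traject T pZ lesp) => i /andP[i0 lei] [_].
move/eqP; rewrite eqn_leq => /andP[+ _].
by rewrite leqNgt ltn_subrL i0 (leq_trans i0) // (leq_trans lei).
Qed.

(** The path [p] stays in layer [l], and the branches from its two ends climb [s] levels to a common
    ancestor. They cannot meet earlier, since branches that meet stay together. *)
Lemma tree_cycle Z v d par l b p s : bfs_tree Z v d par ->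
  b \in layer Z d l -> path_in (layer Z d l) b p -> 0 < s <= l -> 0 < size p ->
  iter s par b = iter s par (last b p) ->
  iter s.-1 par b <> iter s.-1 par (last b p) ->
  has_cycle G (2 * s + size p).
Proof.
move=> T bl [pp up sp] /andP[s0 lesl] p0 eqs neqs.
set a := last b p in eqs neqs.
have al : a \in layer Z d l.
  by have := mem_last b p; rewrite -/a inE => /predU1P[->|/sp].
have dl z : z \in layer Z d l -> d z = l by rewrite inE => /andP[_ /eqP].
have Zl z : z \in layer Z d l -> z \in Z by rewrite inE => /andP[].
(* The common ancestor is counted in [ta] only; [tb] stops one level below it. *)
pose ta := traject par (par a) s; pose tb := traject par (par b) s.-1.
exists (b :: p ++ ta ++ rev tb); split; first by lia.
  by rewrite /= !size_cat size_rev !size_traject; lia.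
have dtb z : z \in rev tb ->
    exists2 i, 0 < i <= s.-1 & z = iter i par b /\ d z = l - i.
  rewrite mem_rev => zt; rewrite -(dl b bl).
  by apply: (ancestor_traject T) zt; rewrite ?dl ?Zl; lia.
have dta z : z \in ta ->
    exists2 i, 0 < i <= s & z = iter i par a /\ d z = l - i.
  move=> zt; rewrite -(dl a al).
  by apply: (ancestor_traject T) zt; rewrite ?dl ?Zl.
apply/andP; split.
  rewrite /= rcons_cat cat_path pp rcons_cat cat_path -/a.
  rewrite (ancestor_path T) ?Zl ?dl //=.
  have := ancestor_path T (Zl b bl); rewrite dl // => /(_ s lesl) pb.
  have : path (fun x => (@adj G)^~ x) b (traject par (par b) s).
    by rewrite (eq_path (e' := @adj G)) // => x y /=; rewrite adj_sym.
  rewrite -rev_path.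
  have -> : traject par (par b) s = rcons tb (iter s par b).
    by rewrite -(prednK s0) trajectSr -iterSr.
  by rewrite belast_rcons last_rcons rev_cons /ta last_traject eqs.
rewrite -cat_cons cat_uniq up cat_uniq rev_uniq !(ancestor_uniq T) ?dl ?Zl //;
  last lia.
rewrite andbT /=; apply/andP; split; apply/hasPn => z.
  rewrite mem_cat => /orP[/dta|/dtb] [i lei [_ dz]]; rewrite inE;
    apply/negP => /predU1P[zb|/sp /dl]; try (by lia);
    move: dz; rewrite zb dl //; lia.
(* A vertex on both branches sits at the same height on each, which would make them agree at height
   [s.-1]. *)
case/dtb=> i lei [zb dz]; apply/negP => /dta[j lej [za dz']].
have eij : i = j by lia.
rewrite {}eij in zb lei dz *; case: neqs.
have -> : s.-1 = (s.-1 - j) + j by lia.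
by rewrite !iterD -zb -za.
Qed.

(** * Independence ratio and growth of the layers *)

Lemma constant_or_separated (R : eqType) K (g : G -> R) : K != set0 ->
  {in K &, forall x y, g x = g y} \/
  exists2 A : {set G}, A \subset K & [/\ A != set0, A != K &
    {in A & K :\: A, forall x y, g x <> g y}].
Proof.
case/set0Pn=> x0 x0K.
have [/forall_inP c|] := boolP [forall x in K, g x == g x0].
  by left=> x y /c/eqP-> /c/eqP->.
rewrite negb_forall => /existsP[y0]; rewrite negb_imply => /andP[y0K ny0].
(* The fibre of [g] through [x0] is separated from the rest of [K]. *)
right; exists [set x in K | g x == g x0].
  by apply/subsetP => x; rewrite inE => /andP[].
split.
- by apply/set0Pn; exists x0; rewrite inE x0K /=.
- by apply: contraNneq ny0 => /setP/(_ y0); rewrite inE y0K /=.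
- move=> x y; rewrite !inE => /andP[xK /eqP gx] /andP[+ yK].
  by rewrite yK gx /= => ny e; rewrite -e eqxx in ny.
Qed.

Local Open Scope ring_scope.

(** For a maximum independent [S] in a small [Y], the closed neighbourhood of [Y] has at least
    [2 * f * #|S|] vertices, and [f * #|S| >= #|Y|]. *)
Lemma minimal_dense_expand (R : realFieldType) (f : R) D A :
  0 < f -> A != set0 -> 2 * f * (alpha A)%:R <= #|A|%:R ->
  (forall Y, Y \subset A -> Y != set0 -> (#|Y| <= D)%N ->
     #|Y|%:R <= f * (alpha Y)%:R) ->
  exists A', [/\ A' \subset A, A' != set0 &
    forall Y, Y \subset A' -> Y != set0 -> (#|Y| <= D)%N ->
     (#|Y|.*2 <= #|closed_nbhd A' Y|)%N].
Proof.
move=> f0 A0 badA small.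
have [|A' [sA'A A'0 _ _ ex]] := minimal_dense _ A0 badA.
  by rewrite mulr_ge0 // ltW.
exists A'; split=> // Y sYA' Y0 leYD.
have [S [sSY iS eS]] := alpha_witness Y.
have := small Y (subset_trans sYA' sA'A) Y0 leYD.
have := ex S (subset_trans sSY sYA') iS.
have : #|closed_nbhd A' S|%:R <= #|closed_nbhd A' Y|%:R :> R.
  by rewrite ler_nat subset_leq_card // closed_nbhd_mono.
rewrite -eS -(ler_nat R) -mul2n natrM.
move: (#|_|%:R) (#|_|%:R) (#|_|%:R) (#|_|%:R) => a b c e h1 h2 h3; lra.
Qed.

(** In the constant [4 * f], one factor 2 pays for splitting [K] into two groups of branches and the
    other for the expansion inside a group. *)
Lemma layer_alpha (R : realFieldType) (f : R) Z v d par l D Y :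
  bfs_tree Z v d par -> (0 < D)%N ->
  (forall X, X \subset Z -> X != set0 -> (#|X| <= D)%N ->
     #|X|%:R <= f * (alpha X)%:R) ->
  (forall s, (0 < s <= l)%N ->
     exists2 w, (0 < w <= D)%N & ~ has_cycle G (2 * s + w)) ->
  Y \subset layer Z d l -> Y != set0 ->
  #|Y|%:R < 4 * f * (alpha Y)%:R.
Proof.
move=> T D0 small nocyc sYl Y0; rewrite ltNge; apply/negP => badY.
have sYZ : Y \subset Z.
  by apply: subset_trans sYl _; apply/subsetP => x; rewrite inE => /andP[].
have f1 : 1 <= f.
  case/set0Pn: Y0 => y yY.
  have := small [set y]; rewrite sub1set (subsetP sYZ) // cards1 => /(_ isT).
  have -> : alpha [set y] = 1%N.
    apply/eqP; rewrite eqn_leq alpha_gt0 -?card_gt0 ?cards1 // andbT.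
    have [S [sS _ <-]] := alpha_witness [set y].
    by rewrite -(cards1 y) subset_leq_card.
  by rewrite -card_gt0 cards1 mulr1 => /(_ isT D0).
have [|K [sKY K0 badK cK _]] := minimal_dense _ Y0 badY.
  by rewrite mulr_ge0 // (le_trans _ f1).
have sKl := subset_trans sKY sYl.
have Kl x : x \in K -> x \in Z /\ d x = l.
  by move/(subsetP sKl); rewrite inE => /andP[-> /eqP].
pose P s := [forall x in K, forall y in K, iter s par x == iter s par y].
have PP s : reflect {in K &, forall x y, iter s par x = iter s par y} (P s).
  apply: (iffP forall_inP) => [H x y xK yK|H x xK].
    by have /forall_inP/(_ y yK)/eqP := H x xK.
  by apply/forall_inP => y yK; apply/eqP/H.
(* After [l] steps every branch is at the root, so a least common height [s] exists. *)
have Pl : P l.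
  apply/PP => x y /Kl[xZ dx] /Kl[yZ dy].
  have root z : z \in Z -> d z = l -> iter l par z = v.
    move=> zZ dz; have [|] := iter_par (i := l) T zZ; first by rewrite dz.
    by rewrite dz subnn => iZ; apply: bfs_root T _ iZ.
  by rewrite !root.
have exP : exists s, P s by exists l.
have [s Ps mins] := ex_minnP exP.
have les := mins l Pl.
(* Height 0 would make [K] a single vertex, of ratio 1, which is below [4 * f]. *)
have s0 : (0 < s)%N.
  rewrite lt0n; apply/eqP => s0; move: Ps; rewrite s0 => /PP /= cst.
  case/set0Pn: (K0) => x xK.
  have eK : K = [set x].
    apply/eqP; rewrite eqEsubset sub1set xK andbT; apply/subsetP => y yK.
    by rewrite (cst y x) // set11.
  move: badK; rewrite eK cards1 => badK.
  have : (0 < alpha [set x])%N by rewrite alpha_gt0 -?eK.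
  rewrite -(ler_nat R) => a1.
  have : 4 * f * 1 <= 4 * f * (alpha [set x])%:R.
    by rewrite ler_wpM2l // mulr_ge0 // (le_trans _ f1).
  by lra.
have [|w /andP[w0 lewD] noc] := nocyc s; first by rewrite s0.
have noP : ~ P s.-1 by move/mins; rewrite -ltnS prednK // ltnn.
have [cst|[A0 sAK [A00 nAK dA]]] :=
  constant_or_separated (iter s.-1 par) K0; first by case: noP; apply/PP.
(* A separated group of ratio at least [2 * f] would close a forbidden cycle of length
   [2 * s + w]. *)
have sep (A : {set G}) : A \subset K -> A != set0 -> A != K ->
    {in A & K :\: A, forall x y, iter s.-1 par x <> iter s.-1 par y} ->
    #|A|%:R < 2 * f * (alpha A)%:R.
  move=> sA AN0 AK sepA; rewrite ltNge; apply/negP => badA.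
  have f0 : 0 < f by lra.
  have [|A' [sA'A A'0 ex]] := minimal_dense_expand (D := w) f0 AN0 badA.
    move=> X sXA X0 leX; apply: small => //; last exact: leq_trans lewD.
    by apply: subset_trans sXA (subset_trans sA (subset_trans sKY sYZ)).
  have [b [p [bA [pp up sp] szp]]] := crossing_path cK sA AK sA'A A'0 ex.
  have [bK nbA] : b \in K /\ b \notin A by move: bA; rewrite inE => /andP[].
  have lA : last b p \in A.
    have := mem_last b p; rewrite inE => /predU1P[e|/sp//].
    move: szp w0 up e; case: (p) => [<-//|x q _ _ /= /andP[+ _] e].
    by rewrite -e mem_last.
  apply: noc; rewrite -szp.
  apply: (tree_cycle (l := l) (b := b) (p := p) (s := s) T).
  - exact: (subsetP sKl).
  - by split=> // z /sp/(subsetP sA)/(subsetP sKl).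
  - by rewrite s0.
  - by rewrite szp.
  - by move/PP: Ps; apply=> //; apply: (subsetP sA).
  - by move=> e; apply: (sepA _ _ lA bA).
(* Both sides of the split have ratio below [2 * f]; adding them, with [alpha] of each at most
   [alpha K], contradicts [badK]. *)
have h1 := sep A0 sAK A00 nAK dA.
have h2 : #|K :\: A0|%:R < 2 * f * (alpha (K :\: A0))%:R.
  apply: sep; rewrite ?subsetDl //.
  - by apply: contra nAK; rewrite setD_eq0 eqEsubset sAK.
  - case/set0Pn: A00 => x xA; apply/eqP => /setP/(_ x).
    by rewrite !inE xA (subsetP sAK).
  - move=> x y xD; rewrite setDDr setDv set0U (setIidPr sAK) => yA e.
    by apply: (dA y x).
have cA : (#|A0| + #|K :\: A0| = #|K|)%N.
  by rewrite -(cardsID A0 K) (setIidPr sAK).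
have le1 : 2 * f * (alpha A0)%:R <= 2 * f * (alpha K)%:R.
  by rewrite ler_wpM2l ?ler_nat ?alpha_mono // mulr_ge0 //; lra.
have le2 : 2 * f * (alpha (K :\: A0))%:R <= 2 * f * (alpha K)%:R.
  by rewrite ler_wpM2l ?ler_nat ?alpha_mono ?subsetDl // mulr_ge0 //; lra.
move: badK; rewrite -cA natrD; lra.
Qed.

(* Growth by a factor [5 * q] per layer: an independent set [S] of layer [l]
   with [#|layer l| <= 4 * f * #|S|] has all its neighbours in the layers
   [l - 1], [l] and [l + 1], and [27 / 4 - 1 - 1 / 5 >= 5]. *)
Lemma layers_grow (R : realFieldType) (f q : R) Z v d par H :
  bfs_tree Z v d par -> v \in Z -> 0 < f -> 1 <= q ->
  (forall S, S \subset Z -> independent S ->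
    27 * f * q * #|S|%:R <= #|closed_nbhd Z S|%:R) ->
  (forall l, (l < H)%N -> layer Z d l != set0 ->
    #|layer Z d l|%:R < 4 * f * (alpha (layer Z d l))%:R) ->
  (5 * q) ^+ H <= #|layer Z d H|%:R.
Proof.
move=> T vZ f0 q1 ex lay.
have q0 : 0 < q by lra.
have sub l : layer Z d l \subset Z.
  by apply/subsetP => x; rewrite inE => /andP[].
(* The layer before the root is empty. *)
pose prev l : {set G} := if l is l'.+1 then layer Z d l' else set0.
have step l : (l < H)%N -> layer Z d l != set0 ->
    27 * q * #|layer Z d l|%:R <
    4 * (#|prev l| + #|layer Z d l|
         + #|layer Z d l.+1|)%:R.
  move=> ltl N0; have [S [sSl iS eS]] := alpha_witness (layer Z d l).
  have := lay l ltl N0; rewrite -eS => h1.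
  have h2 := ex S (subset_trans sSl (sub l)) iS.
  have : closed_nbhd Z S \subset prev l :|: layer Z d l :|: layer Z d l.+1.
    apply/subsetP => y; rewrite inE => /andP[yZ].
    case/orP=> [yS|/exists_inP[x xS xy]].
      rewrite !inE; have := subsetP sSl _ yS; rewrite inE => ->.
      by rewrite orbT.
    have := subsetP sSl _ xS; rewrite inE => /andP[xZ /eqP dx].
    have := bfs_adj T xZ yZ xy.
    have := bfs_adj T yZ xZ; rewrite adj_sym => /(_ xy).
    rewrite dx => le1 le2; rewrite !inE yZ /=.
    have : d y = l.+1 \/ d y = l \/ (d y).+1 = l.
      by move: (d y) le1 le2; clear; lia.
    case=> [->|[->|e]]; rewrite ?eqxx ?orbT //.
    by rewrite /prev -e inE yZ eqxx.
  move=> /subset_leq_card le1.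
  have {le1} : (#|closed_nbhd Z S|
      <= #|prev l| + #|layer Z d l| + #|layer Z d l.+1|)%N.
    apply: leq_trans le1 _; apply: leq_trans (leq_card_setU _ _).1 _.
    by rewrite leq_add2r (leq_card_setU _ _).1.
  rewrite -(ler_nat R) => h3.
  have : 27 * q * #|layer Z d l|%:R < 27 * q * (4 * f * #|S|%:R).
    by rewrite ltr_pM2l // mulr_gt0.
  by lra.
(* The lower bound keeps the layer nonempty, as [step] requires; the growth of the previous layer
   bounds [prev] by a fifth of the current one. *)
have grow l : (l <= H)%N -> (5 * q) ^+ l <= #|layer Z d l|%:R /\
    ((l < H)%N -> 5 * q * #|layer Z d l|%:R <= #|layer Z d l.+1|%:R).
  elim: l => [|l IHl] leH.
    have c0 : (1 <= #|layer Z d 0|)%N.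
      by apply/card_gt0P; exists v; rewrite inE vZ (bfs_v T) eqxx.
    have c0' : 1 <= #|layer Z d 0|%:R :> R by rewrite ler1n.
    split=> // lt; have := step 0%N lt; rewrite -card_gt0 c0 => /(_ isT).
    rewrite cards0 add0n natrD => h.
    have : 1 * #|layer Z d 0|%:R <= q * #|layer Z d 0|%:R.
      by rewrite ler_pM2r //; lra.
    by lra.
  have [h1 /(_ leH) h2] := IHl (ltnW leH).
  have h3 : (5 * q) ^+ l.+1 <= #|layer Z d l.+1|%:R.
    rewrite exprS; apply: le_trans h2; rewrite ler_pM2l //; lra.
  split=> // lt; have := step l.+1 lt.
  have p0 : 0 < #|layer Z d l.+1|%:R :> R.
    by apply: lt_le_trans h3; rewrite exprn_gt0 //; lra.
  rewrite -card_gt0 -(ltr_nat R) p0 => /(_ isT); rewrite !natrD => h.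
  have : 1 * #|layer Z d l.+1|%:R <= q * #|layer Z d l.+1|%:R.
    by rewrite ler_pM2r.
  have : 1 * #|layer Z d l|%:R <= q * #|layer Z d l|%:R by rewrite ler_wpM2r.
  by lra.
by have [] := grow H (leqnn H).
Qed.

End Graphs.

(** * From small sets to larger sets *)

Local Open Scope ring_scope.

(** If the bound fails, layer [H] of a minimal dense subset has at least [(5 * q) ^+ H] vertices,
    more than [q ^+ H >= #|X|]. *)
Lemma cycle_free_alpha (R : realFieldType) (G : sgraph) (f q : R)
    (X : {set G}) (D H : nat) :
  (0 < D)%N -> (0 < H)%N -> 1 <= q ->
  (forall Y : {set G}, Y != set0 -> (#|Y| <= D)%N ->
     #|Y|%:R <= f * (alpha Y)%:R) ->
  (forall s, (0 < s < H)%N ->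
     exists2 w, (0 < w <= D)%N & ~ has_cycle G (2 * s + w)) ->
  X != set0 -> #|X|%:R <= q ^+ H -> #|X|%:R < 27 * f * q * (alpha X)%:R.
Proof.
move=> D0 H0 q1 small nocyc X0 leX; rewrite ltNge; apply/negP => badX.
have f0 : 0 < f.
  case/set0Pn: X0 => x _; have := small [set x].
  rewrite -card_gt0 cards1 => /(_ isT D0).
  have : 0 <= (alpha [set x])%:R :> R by [].
  move=> a0 h; rewrite ltNge; apply/negP => f0.
  by have := mulr_le0_ge0 f0 a0; lra.
have [|Z [sZX Z0 _ cZ ex]] := minimal_dense _ X0 badX.
  by rewrite !mulr_ge0 //; lra.
case/set0Pn: Z0 => v vZ; have [d [par T]] := bfs_tree_exists cZ vZ.
have lay l : (l < H)%N -> layer Z d l != set0 ->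
    #|layer Z d l|%:R < 4 * f * (alpha (layer Z d l))%:R.
  move=> ltl N0; apply: (layer_alpha T D0) => // [Y _|s /andP[s0 lesl]].
    exact: small.
  by apply: nocyc; rewrite s0 (leq_ltn_trans lesl).
have := layers_grow (H := H) T vZ f0 q1 ex lay; apply/negP; rewrite -ltNge.
apply: le_lt_trans (_ : q ^+ H < _).
  apply: le_trans leX; rewrite ler_nat subset_leq_card //.
  by apply: subset_trans sZX; apply/subsetP => x; rewrite inE => /andP[].
by rewrite ltrXn2r -?lt0n //; lra.
Qed.

(** * Forbidden cycle lengths just above even numbers *)

Section Sequences.
Variables (sigma tau : nat -> nat).
Hypothesis sigma_incr : strictly_increasing sigma.
Hypothesis sigma1_ge3 : (3 <= sigma 1)%N.
Hypothesis tau_sub : subsequence tau sigma.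
Hypothesis tau1 : tau 1%N = sigma 1%N.
Hypothesis tau0 : tau 0%N = 1%N.

Local Open Scope nat_scope.

Lemma sigma_ge j : 0 < j -> j <= sigma j.
Proof.
elim: j => // -[|j] IHj _; first by rewrite (leq_trans _ sigma1_ge3).
by apply: leq_ltn_trans (IHj isT) _; apply: sigma_incr.
Qed.

Lemma tau_mono i j : 0 < i -> i <= j -> tau i <= tau j.
Proof.
move=> i0; rewrite leq_eqVlt => /predU1P[->//|ltij].
have [k [k0 kincr tauk]] := tau_sub.
rewrite !tauk // ?(leq_trans i0 (ltnW ltij)) // ltnW // sigma_incr ?k0 //.
exact: kincr.
Qed.

Lemma tau_gt0 i : 0 < tau i.
Proof.
case: i => [|i]; first by rewrite tau0.
by apply: leq_trans (tau_mono (_ : 0 < 1) _) => //; rewrite tau1; lia.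
Qed.

(** Take the first [sigma j] above [2 * s]; it is at most [tau r], itself such a term. Either
    [j = 1] and [w <= sigma 1 - 2], or the preceding term is at most [2 * s] and [w] is at most a
    gap. *)
Lemma sigma_window r s : 0 < r -> 0 < s -> s.*2 < tau r ->
  exists w j, [/\ 0 < w <= maxn (gap sigma tau r) (sigma 1 - 2), 0 < j,
    sigma j <= tau r & sigma j = 2 * s + w].
Proof.
move=> r0 s0 lts.
have [k [k0 kincr tauk]] := tau_sub.
have exj : exists j, (0 < j) && (s.*2 < sigma j).
  by exists (k r); rewrite k0 // -tauk.
have [j /andP[j0 ltj] minj] := ex_minnP exj.
have lejk : j <= k r by apply: minj; rewrite k0 // -tauk.
have lejt : sigma j <= tau r.
  rewrite tauk //; move: lejk; rewrite leq_eqVlt => /predU1P[->//|ltjk].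
  exact/ltnW/sigma_incr.
exists (sigma j - s.*2), j; split=> //; last first.
  by rewrite mul2n subnKC // ltnW.
rewrite subn_gt0 ltj leq_max /=.
have [j1|nj1] := eqVneq j 1.
  by apply/orP; right; rewrite j1; lia.
(* For [r = 1] only [sigma 1] is available, and [gap] is 1 there by convention. *)
have r1 : 1 < r.
  rewrite ltn_neqAle r0 andbT; apply: contra nj1 => /eqP r1.
  have : sigma j <= sigma 1 by rewrite -tau1 r1.
  apply: contraTT => nj; rewrite -ltnNge; apply: sigma_incr => //.
  by rewrite ltn_neqAle eq_sym nj.
apply/orP; left; rewrite /gap (leqNgt r 1) r1 /=.
have j2 : 1 < j by rewrite ltn_neqAle eq_sym nj1.
have pj : sigma j.-1 <= s.*2.
  rewrite leqNgt; apply/negP => lt.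
  have : j <= j.-1 by apply: minj; rewrite lt andbT; lia.
  lia.
apply: leq_trans (leq_sub2l _ pj) _.
apply: (leq_bigmax_seq (F := fun j => sigma j - sigma j.-1)) => //.
by rewrite mem_index_iota j2 ltnS (leq_trans (sigma_ge j0)).
Qed.

Lemma cycle_free_family_le (G : sgraph) i r : 0 < i -> i <= r ->
  cycle_free_family sigma tau r G -> cycle_free_family sigma tau i G.
Proof.
move=> i0 leir free j j0 lej; apply: free => //.
exact: leq_trans lej (tau_mono i0 leir).
Qed.

(** * The numerical bound and the induction on [r] *)

Local Open Scope ring_scope.
Variable R : realType.

Definition gap_sum r : R :=
  \sum_(1 <= i < r.+1) (2%:R * ln (gap sigma tau i)%:R / (tau i.-1)%:R).

(** Here [m] is the size of a vertex set, not of the whole graph, so that [m = gap sigma tau r] can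
    be inserted in the induction. *)
Definition ratio_bound r (m : nat) : R :=
  27%:R ^+ r * (sigma 1%N)%:R *
    expR (gap_sum r + 2%:R * ln m%:R / (tau r)%:R).

Lemma ln_nat_ge0 (m : nat) : 0 <= ln m%:R :> R.
Proof.
by case: m => [|m]; [rewrite ln0|rewrite ln_ge0 // ler1n].
Qed.

Lemma gap_sum_ge0 r : 0 <= gap_sum r.
Proof.
by apply: sumr_ge0 => i _; rewrite divr_ge0 // mulr_ge0 // ln_nat_ge0.
Qed.

Lemma ratio_bound_gt0 r m : 0 < ratio_bound r m.
Proof. by rewrite !mulr_gt0 ?expR_gt0 ?exprn_gt0 // ltr0n; lia. Qed.

Lemma ratio_bound_mono r m m' : (0 < m <= m')%N ->
  ratio_bound r m <= ratio_bound r m'.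
Proof.
case/andP=> m0 lem.
rewrite ler_pM2l ?mulr_gt0 ?exprn_gt0 ?ltr0n //; last by lia.
rewrite ler_expR lerD2l ler_pM2r ?invr_gt0 ?ltr0n ?tau_gt0 //.
rewrite ler_pM2l // ler_ln ?ler_nat // posrE ltr0n //.
exact: leq_trans lem.
Qed.

(** If the gap dominates, [f] is the bound for [r.-1] at the gap: its logarithmic term is the last
    summand of [gap_sum r]. Otherwise sets of at most [sigma 1 - 2] vertices trivially have ratio at
    most [sigma 1]. *)
Lemma gap_ratio_ge r (G : sgraph) (D := maxn (gap sigma tau r) (sigma 1 - 2)) :
  (0 < r)%N ->
  (forall X : {set G}, (1 < r)%N -> X != set0 ->
     #|X|%:R < ratio_bound r.-1 #|X| * (alpha X)%:R) ->
  exists2 f : R, 27 * f <= 27 ^+ r * (sigma 1)%:R * expR (gap_sum r) &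
    forall Y : {set G}, Y != set0 -> (#|Y| <= D)%N ->
      #|Y|%:R <= f * (alpha Y)%:R.
Proof.
move=> r0 IH; rewrite {}/D.
have [le|lt] := leqP (gap sigma tau r) (sigma 1 - 2).
  exists (sigma 1)%:R.
    rewrite mulrAC ler_pM2r; last by rewrite ltr0n; lia.
    apply: le_trans (_ : 27 ^+ r * 1 <= _); last first.
      by rewrite ler_pM2l ?exprn_gt0 // -[leLHS]expR0 ler_expR gap_sum_ge0.
    rewrite mulr1 -(prednK r0) exprS ler_pMr // exprn_ege1 //; lra.
  move=> Y Y0 leY; rewrite -natrM ler_nat.
  apply: leq_trans leY (leq_trans (leq_subr _ _) _).
  by rewrite leq_pmulr // alpha_gt0.
(* For [r = 1] the gap is 1, which is at most [sigma 1 - 2]. *)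
have r1 : (1 < r)%N.
  by move: lt; rewrite /gap ltnNge; case: leqP => // _; lia.
exists (ratio_bound r.-1 (gap sigma tau r)); last first.
  move=> Y Y0 leY; apply: le_trans (ltW (IH Y r1 Y0)) _.
  by rewrite ler_wpM2r // ratio_bound_mono // card_gt0 Y0.
rewrite /ratio_bound /gap_sum prednK // [in leRHS]big_nat_recr //=.
by rewrite !mulrA -exprS prednK.
Qed.

Lemma cycle_free_ratio r (G : sgraph) (X : {set G}) : (0 < r)%N ->
  cycle_free_family sigma tau r G -> X != set0 ->
  #|X|%:R < ratio_bound r #|X| * (alpha X)%:R.
Proof.
elim: r X => // r IHr X _ free X0.
have [|Y r1 Y0|f lef small] := @gap_ratio_ge r.+1 G; first by [].
  by apply: IHr => //; apply: cycle_free_family_le free.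
set D := maxn _ _ in small.
(* This is [#|X|] to the power [2 / tau r.+1]. *)
pose q : R := expR (2 * ln #|X|%:R / (tau r.+1)%:R).
have q1 : 1 <= q.
  by rewrite -expR0 ler_expR divr_ge0 // mulr_ge0 // ln_nat_ge0.
have X1 : (0 < #|X|)%N by rewrite card_gt0.
have t0 := tau_gt0 r.+1.
have D0 : (0 < D)%N by rewrite leq_max; apply/orP; right; lia.
(* Rounding half of [tau] up gives both needs: [s < H] still means [2 * s < tau r.+1], and
   [q ^+ H >= #|X|]. *)
have H0 : (0 < uphalf (tau r.+1))%N by rewrite uphalf_gt0.
apply: lt_le_trans (cycle_free_alpha D0 H0 q1 small _ X0 _) _.
- move=> s /andP[s0 ltsH].
  have [|w [j [wD j0 lej ej]]] := sigma_window (ltn0Sn r) s0.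
    by move: ltsH; rewrite geq_uphalf_double doubleS ltnS.
  by exists w => //; rewrite -ej; apply: free.
- rewrite -expRM_natl -[leLHS]lnK ?posrE ?ltr0n // ler_expR.
  rewrite mulrA ler_pdivlMr ?ltr0n // mulrA mulrC ler_wpM2r ?ln_nat_ge0 //.
  by rewrite -natrM ler_nat; lia.
- rewrite ler_wpM2r // /ratio_bound expRD mulrA.
  by rewrite ler_wpM2r // expR_ge0.
Qed.

End Sequences.

(** * Passage from vertex sets to the supremum *)

Theorem theorem7 (R : realType) (sigma tau : nat -> nat)
    (sigma_incr : strictly_increasing sigma) (sigma1_ge3 : (3 <= sigma 1)%N)
    (tau_sub : subsequence tau sigma) (tau1 : tau 1%N = sigma 1%N)
    (tau0 : tau 0%N = 1%N)
    (r : nat) (r_ge1 : (1 <= r)%N) (n : nat) (G : sgraph) (cardG : #|G| = n)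
    (G_free : cycle_free_family sigma tau r G) :
  iota_ratio R G <
    27%:R ^+ r * (sigma 1%N)%:R *
    expR (\sum_(1 <= i < r.+1)
             (2%:R * ln (gap sigma tau i)%:R / (tau i.-1)%:R)
          + 2%:R * ln n%:R / (tau r)%:R).
Proof.
rewrite -/(gap_sum sigma tau R r) -/(ratio_bound sigma tau R r n).
have B0 : 0 < ratio_bound sigma tau R r n by apply: ratio_bound_gt0.
rewrite /iota_ratio; set E := (X in sup X).
(* Without vertices the supremum is 0 by convention, below a positive bound. *)
have [x _|G0] := pickP (@predT G); last first.
  have -> : E = classical_sets.set0.
    apply/classical_sets.seteqP; split=> // q [X [/card_gt0P[x _] _]].
    by have := G0 x.
  by rewrite sup0.
have x0 : [set x] != set0 by apply/set0Pn; exists x; rewrite set11.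
(* The supremum is bounded by the ratio of a maximising [X], which keeps the inequality strict. *)
have [/= X X0 maxX] := @Order.TotalTheory.arg_maxP _ _ _ [set x]
  [pred X : {set G} | X != set0] (fun X => #|X|%:R / (alpha X)%:R : R) x0.
apply: le_lt_trans (_ : #|X|%:R / (alpha X)%:R < _).
  apply: ge_sup; first by exists (#|X|%:R / (alpha X)%:R), X; rewrite card_gt0.
  by move=> _ [Y [Y0 ->]]; apply: maxX; rewrite /= -card_gt0.
rewrite ltr_pdivrMr ?ltr0n ?alpha_gt0 //.
apply: (lt_le_trans (y := ratio_bound sigma tau R r #|X| * (alpha X)%:R)).
  exact: cycle_free_ratio.
rewrite ler_wpM2r // ratio_bound_mono // card_gt0 X0 /=.
by rewrite -cardG max_card.
Qed.
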